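(* Let $\lambda,\mu>0$ be such that $\lambda\mu<4$, let $T:\mathcal H\to\mathcal H$ be $\lambda$-RFNE and $U:\mathcal H\to\mathcal H$ be $\mu$-RFNE with $\operatorname{Fix}(UT)\neq\emptyset$, and let $\nu^*:=\frac{4(\lambda+\mu-\lambda\mu)}{4-\lambda\mu}$. Let $x^0\in\mathcal H$, let $\lambda_k\in[\varepsilon,2-\varepsilon]$, $k\ge0$, for some $\varepsilon\in(0,1)$, and let $$x^{k+1}=x^k+\frac{\lambda_k}{\nu^*}\big(UT(x^k)-x^k\big),\qquad k\ge0.$$ Then $\{x^k\}_{k=0}^\infty$ converges weakly to an element of $\operatorname{Fix}(UT)$.
   Context: $\mathcal H$ is a real Hilbert space with $\mathcal H\neq\{0\}$; $UT$ denotes the composition $U\circ T$; $\operatorname{Fix}S:=\{z\in\mathcal H:S(z)=z\}$. $S:\mathcal H\to\mathcal H$ is firmly nonexpansive (FNE) if $\langle S(x)-S(y),x-y\rangle\ge\|S(x)-S(y)\|^2$ for all $x,y\in\mathcal H$. For $\lambda>0$, $T$ is $\lambda$-relaxed firmly nonexpansive ($\lambda$-RFNE) if $T=\operatorname{Id}+\lambda(S-\operatorname{Id})$ for some FNE operator $S$. *)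

(* Defs.v *)
From HB Require Import structures.
From mathcomp Require Import all_boot all_order all_algebra.
From mathcomp Require Import sesquilinear.
From mathcomp Require Import all_classical all_reals.
From mathcomp Require Import topology normedtype sequences.

Set Implicit Arguments.
Unset Strict Implicit.
Unset Printing Implicit Defensive.

Import Order.TTheory GRing.Theory Num.Theory.
Import numFieldNormedType.Exports.

Local Open Scope classical_set_scope.
Local Open Scope ring_scope.

(* A real Hilbert space is a complete normed space over a realType whose norm
   comes from a positive definite symmetric bilinear form. *)
HB.mixin Record NormedModule_hasInner (R : realType) H & NormedModule R H := {
  inner : {dot H for idfun};
  inner_normE : forall x : H, inner x x = `|x| ^+ 2;
}.

#[short(type="hilbertType")]
HB.structure Definition Hilbert (R : realType) :=
  {H of CompleteNormedModule R H & NormedModule_hasInner R H}.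

Notation "''[' u , v ]" := (inner u v) : ring_scope.

Definition fixpoints (E : Type) (S : E -> E) : set E := [set z | S z = z].

Section Operators.
Context {R : realType} {H : hilbertType R}.

Definition firmly_nonexpansive (S : H -> H) : Prop :=
  forall x y : H, '[S x - S y, x - y] >= `|S x - S y| ^+ 2.

Definition relaxed_firmly_nonexpansive (lambda : R) (T : H -> H) : Prop :=
  exists2 S : H -> H, firmly_nonexpansive S &
    forall x : H, T x = x + lambda *: (S x - x).

(* By the Riesz representation theorem the functionals '[-, y] are exactly
   the continuous linear functionals on H. *)
Definition weakly_converges (x : nat -> H) (z : H) : Prop :=
  forall y : H, '[x k, y] @[k --> \oo] --> '[z, y].

End Operators.

(* Main.v *)
Require Import Defs.
From mathcomp Require Import all_boot all_order all_algebra.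
From mathcomp Require Import sesquilinear interval_inference ring lra.
From mathcomp Require Import all_classical all_reals.
From mathcomp Require Import topology normedtype sequences.

Set Implicit Arguments.
Unset Strict Implicit.
Unset Printing Implicit Defensive.

Import Order.TTheory GRing.Theory Num.Theory.
Import numFieldNormedType.Exports.

Local Open Scope classical_set_scope.
Local Open Scope ring_scope.

(** Write [A := nu^-1 *: (Id - U \o T)]. The zeros of [A] are the fixed points
    of [U \o T], and the iteration reads [x k.+1 = x k - lambda_ k *: A (x k)].

    - [A] is firmly nonexpansive. A firmly nonexpansive [S] has a firmly
      nonexpansive complement [Id - S], so the hypotheses on [T] and [U] bound
      the squared increments of [Id - T] and [Id - U] by inner products
      ([relaxed_firmly_nonexpansiveP]). The increments of [Id - U \o T] are sums
      of increments of these two, and with the constant [nu] the slack in the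
      resulting bound is a perfect square ([cocoercive_sum]).

    - For a zero [z] of [A], expanding [`|x k.+1 - z| ^+ 2] gives
      [eps ^+ 2 * `|A (x k)| ^+ 2 <= `|x k - z| ^+ 2 - `|x k.+1 - z| ^+ 2]. So
      the distances to all zeros converge and [A (x k)] tends to [0]
      ([Krasnoselskii_Mann]).

    - Weak compactness is used through ultrafilters: along an ultrafilter every
      bounded real function converges, so for a bounded [x] the limits of
      ['[x k, y]] define a bounded linear functional of [y], which the Riesz
      representation theorem turns into a weak limit ([ultra_weak_cvg]). This
      limit is a zero of [A] by monotonicity
      ([firmly_nonexpansive_demiclosed]).

    - Two such limits [z] and [z'] are equal by Opial's argument ([Opial]):
      [`|x k - z'| ^+ 2 - `|x k - z| ^+ 2] converges along the whole sequence,
      hence so does ['[x k, z - z']], whose limit is both ['[z, z - z']] and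
      ['[z', z - z']]. A sequence converging to one and the same limit along
      every ultrafilter finer than [\oo] converges ([cvg_ultra]). *)

(** * Inner products *)

Section InnerProduct.
Context {R : realType} {H : hilbertType R}.
Implicit Types (x y z : H) (a : R).

Lemma innerC x y : '[x, y] = '[y, x].
Proof. by rewrite (@hermitian_subproof _ _ _ _ (@inner R H)) expr0 mul1r. Qed.

Lemma innerDl x y z : '[x + y, z] = '[x, z] + '[y, z].
Proof. exact: linearDl. Qed.

Lemma innerZl a x y : '[a *: x, y] = a * '[x, y].
Proof. exact: linearZl_LR. Qed.

Lemma innerNl x y : '[- x, y] = - '[x, y].
Proof. exact: linearNl. Qed.

Lemma innerDr x y z : '[x, y + z] = '[x, y] + '[x, z].
Proof. by rewrite innerC innerDl !(innerC x). Qed.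

Lemma innerZr a x y : '[x, a *: y] = a * '[x, y].
Proof. by rewrite innerC innerZl innerC. Qed.

Lemma innerNr x y : '[x, - y] = - '[x, y].
Proof. by rewrite innerC innerNl innerC. Qed.

Definition inner_lin :=
  (innerDl, innerDr, innerZl, innerZr, innerNl, innerNr).

Lemma norm_sqD x y : `|x + y| ^+ 2 = `|x| ^+ 2 + 2 * '[x, y] + `|y| ^+ 2.
Proof. by rewrite -!inner_normE !inner_lin (innerC y x); ring. Qed.

Lemma norm_sqB x y : `|x - y| ^+ 2 = `|x| ^+ 2 - 2 * '[x, y] + `|y| ^+ 2.
Proof. by rewrite norm_sqD innerNr normrN; ring. Qed.

Lemma norm_sqZ a x : `|a *: x| ^+ 2 = a ^+ 2 * `|x| ^+ 2.
Proof. by rewrite -!inner_normE !inner_lin; ring. Qed.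

Lemma Cauchy_Schwarz x y : `|'[x, y]| <= `|x| * `|y|.
Proof.
rewrite -ler_sqr ?nnegrE ?mulr_ge0// real_normK ?num_real// exprMn.
have [->|y0] := eqVneq y 0; first by rewrite -(scale0r y) innerZr; nra.
have ny0 : 0 < `|y| ^+ 2 by rewrite exprn_gt0// normr_gt0.
have : 0 <= `|(`|y| ^+ 2) *: x - '[x, y] *: y| ^+ 2 by apply: sqr_ge0.
rewrite norm_sqB !norm_sqZ !inner_lin => h.
have : 0 <= `|y| ^+ 2 * (`|x| ^+ 2 * `|y| ^+ 2 - '[x, y] ^+ 2) by nra.
by rewrite pmulr_rge0// subr_ge0.
Qed.

End InnerProduct.

(** * Riesz representation *)

Section Riesz.
Context {R : realType} {H : hilbertType R}.
Context (phi : H -> R) (M : R).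
Context (phi_linear : forall a y y', phi (a *: y + y') = a * phi y + phi y').
Context (phi_bounded : forall y, phi y <= M * `|y|).

(** A vector whose value of [w |-> `|w| ^+ 2 - 2 * phi w] is within [e ^+ 2] of
    the infimum represents [phi] up to [e]: moving from it in the direction [y]
    by the optimal step would lower the value by
    [(phi y - '[w, y]) ^+ 2 / `|y| ^+ 2]. *)
Lemma approx_Riesz (e : R) : 0 < e ->
  exists w : H, forall y, `|phi y - '[w, y]| <= e * `|y|.
Proof.
move=> e0; pose J w := `|w| ^+ 2 - 2 * phi w.
have hJ : has_inf (range J).
  split; first by exists (J 0), 0.
  exists (- M ^+ 2) => _ [w _ <-]; rewrite /J.
  have := phi_bounded w; have := sqr_ge0 (`|w| - M); nra.
have [_ [w _ <-] Jw] := inf_adherent (exprn_gt0 2 e0) hJ.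
have Jmin v : inf (range J) <= J v by apply: ge_inf; [exact: hJ.2|exists v].
exists w => y.
rewrite -ler_sqr ?nnegrE ?mulr_ge0 ?(ltW e0)// real_normK ?num_real// exprMn.
have [->|y0] := eqVneq y 0.
  have := phi_linear (-1) 0 0; rewrite scaler0 addr0 => p0.
  by rewrite -(scale0r 0) innerZr scale0r; nra.
have ny0 : 0 < `|y| ^+ 2 by rewrite exprn_gt0// normr_gt0.
have ny1 := lt0r_neq0 ny0.
(* The step minimises the quadratic polynomial t |-> J (t *: y + w). *)
set d := phi y - _; have := Jmin ((d / `|y| ^+ 2) *: y + w).
rewrite [J (_ + w)]/J norm_sqD norm_sqZ phi_linear innerZl (innerC y w).
have -> : (d / `|y| ^+ 2) ^+ 2 * `|y| ^+ 2 + 2 * (d / `|y| ^+ 2 * '[w, y]) +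
  `|w| ^+ 2 - 2 * (d / `|y| ^+ 2 * phi y + phi w) = J w - d ^+ 2 / `|y| ^+ 2.
  by rewrite /J /d; field; move: ny1; rewrite sqrf_eq0.
by rewrite -ler_pdivrMr//; lra.
Qed.

(** Approximate representatives with errors [e] and [e'] differ by at most
    [e + e'] in norm, as one sees by testing them against their own difference;
    so they form a Cauchy sequence as the error goes to [0]. *)
Lemma Riesz : exists z : H, forall y, phi y = '[z, y].
Proof.
have /choice[w wP] (n : nat) :
    exists w : H, forall y, `|phi y - '[w, y]| <= n.+1%:R^-1 * `|y|.
  by apply: approx_Riesz; rewrite invr_gt0 ltr0n.
have dist m n : `|w m - w n| <= m.+1%:R^-1 + n.+1%:R^-1.
  have [->|mn] := eqVneq (w m) (w n).
    by rewrite subrr normr0 addr_ge0 // invr_ge0 ler0n.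
  have n0 : 0 < `|w m - w n| by rewrite normr_gt0 subr_eq0.
  rewrite -(ler_pM2r n0) -expr2 -inner_normE {1}innerDl innerNl.
  have := wP m (w m - w n); have := wP n (w m - w n).
  rewrite !ler_norml mulrDl.
  move: (n.+1%:R^-1 * _) (m.+1%:R^-1 * _) => p q /andP[? ?] /andP[? ?].
  lra.
have wC : cvg (w @ \oo).
  apply: cauchy_cvg; apply: cauchy_exP => e e0.
  have e20 : 0 < e / 2 by rewrite divr_gt0.
  have [N _ NP] := near_infty_natSinv_lt (PosNum e20).
  exists (w N), N => //= n Nn; rewrite /= -ball_normE /=.
  apply: le_lt_trans (dist N n) _.
  have := NP N (leqnn N); have := NP n Nn; rewrite /=.
  move: (n.+1%:R^-1) (N.+1%:R^-1) => p q; lra.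
exists (lim (w @ \oo)) => y; set z := lim _.
apply/eqP; rewrite -subr_eq0 -normr_le0.
have h1 : (n.+1%:R^-1 * `|y| + `|w n - z| * `|y|) @[n --> \oo] --> (0 : R).
  rewrite -[X in _ --> X](_ : 0 * `|y| + 0 * `|y| = 0); last by ring.
  apply: cvgD; apply: cvgM; try exact: cvg_cst; first exact: cvg_harmonic.
  apply/norm_cvg0P; apply/subr_cvg0; exact: wC.
apply: (cvgr_to_ge h1); near=> n.
have := wP n y; have := Cauchy_Schwarz (w n - z) y.
rewrite innerDl innerNl !ler_norml.
move: (n.+1%:R^-1 * _) (_ * _) => p q /andP[? ?] /andP[? ?].
by apply/andP; split; lra.
Unshelve. all: by end_near. Qed.

End Riesz.

(** * Convergence along ultrafilters *)

Section Ultrafilters.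
Context {T : Type}.

Lemma ultra_fmap (U : Type) (f : T -> U) (G : set_system T) :
  UltraFilter G -> UltraFilter (f @ G).
Proof.
move=> GU; split=> [|K KP GK]; first exact: fmap_proper_filter.
rewrite predeqE => A; split=> [KA|]; last exact: GK.
rewrite /fmap /=; have [//|nA] := in_ultra_setVsetC (f @^-1` A) GU.
have /(filterI KA) : K (~` A) by exact: GK.
by rewrite setICr => /filter_not_empty.
Qed.

Lemma ultra_bounded_cvg (R : realType) (f : T -> R) (M : R) (G : set_system T) :
  UltraFilter G -> (\forall k \near G, `|f k| <= M) -> cvg (f @ G).
Proof.
move=> GU fM; have fU := ultra_fmap f GU.
have := @segment_compact R (- M) M; rewrite compact_ultra => /(_ _ fU)[].
  by apply: filterS fM => k; rewrite /= in_itv /= ler_norml.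
by move=> l [_ fl]; apply/cvg_ex; exists l.
Qed.

(** If some neighborhood of [l] had a preimage [B] outside [F], then [F] and the
    complement of [B] would generate a proper filter, and along an ultrafilter
    containing it [f] would not tend to [l]. *)
Lemma cvg_ultra (V : topologicalType) (f : T -> V) (l : V) (F : set_system T) :
  Filter F ->
  (forall G : set_system T, UltraFilter G -> F `<=` G -> f @ G --> l) ->
  f @ F --> l.
Proof.
move=> FF h A Al; apply: contrapT => nFA.
have WP : ProperFilter (within (~` (f @^-1` A)) F).
  split; last exact: within_filter.
  move=> W; apply: nFA.
  by apply: (@filterS _ F _ _ _ _ W) => k kA; apply: contrapT => /kA.
have [G [GU WG]] := ultraFilterLemma WP.
have GA : G (~` (f @^-1` A)) by apply: WG; exact: withinT.
have FG : F `<=` G by move=> B FB; apply: WG; apply: (@filterS _ F _ _ _ _ FB).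
have /(filterI GA) : G (f @^-1` A) by exact: (h G).
by rewrite setICl => /filter_not_empty.
Qed.

End Ultrafilters.

(** * Weak convergence *)

Section WeakConvergence.
Context {R : realType} {H : hilbertType R}.

(** At [F := \oo] this is convertible to [weakly_converges]; arbitrary filters
    are needed to speak of weak limits along ultrafilters. *)
Definition weak_cvg (T : Type) (F : set_system T) (x : T -> H) (z : H) : Prop :=
  forall y : H, '[x k, y] @[k --> F] --> '[z, y].

(** Weak compactness of balls: the limits of ['[x k, y]] exist for every [y]
    along an ultrafilter, and their dependence on [y] is linear and bounded. *)
Lemma ultra_weak_cvg (T : Type) (G : set_system T) (x : T -> H) (M : R) :
  UltraFilter G -> (\forall k \near G, `|x k| <= M) ->
  exists z, weak_cvg G x z.
Proof.
move=> GU xM.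
have bnd y : \forall k \near G, `|'[x k, y]| <= M * `|y|.
  apply: filterS xM => k xkM; apply: le_trans (Cauchy_Schwarz _ _) _.
  by rewrite ler_wpM2r.
pose phi y := lim ('[x k, y] @[k --> G]).
have phiP y : '[x k, y] @[k --> G] --> phi y := ultra_bounded_cvg GU (bnd y).
have [a y y'|y|z phiz] := @Riesz R H phi M.
- have : '[x k, a *: y + y'] @[k --> G] --> a * phi y + phi y'.
    rewrite (_ : (fun k => _) = (fun k => a * '[x k, y] + '[x k, y'])).
      by apply: cvgD (phiP y'); apply: cvgM (phiP y); exact: cvg_cst.
    by apply/funext => k; rewrite innerDr innerZr.
  by move/(cvg_unique _ (phiP _)); exact.
- apply: (cvgr_to_le (phiP y)); apply: filterS (bnd y) => k.
  exact: le_trans (ler_norm _).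
by exists z => y; rewrite -phiz; exact: phiP.
Qed.

(** Minty's argument: in
    [`|A (x k) - A z| ^+ 2 <= '[A (x k) - A z, x k - z]] the terms containing
    [A (x k)] vanish in the limit because [x] is bounded, and the remaining term
    ['[- A z, x k - z]] vanishes by weak convergence, which leaves
    [`|A z| ^+ 2 <= 0]. *)
Lemma firmly_nonexpansive_demiclosed (T : Type) (F : set_system T)
    (A : H -> H) (x : T -> H) (z : H) (M : R) :
  ProperFilter F -> firmly_nonexpansive A -> (\forall k \near F, `|x k| <= M) ->
  weak_cvg F x z -> A (x k) @[k --> F] --> 0 -> A z = 0.
Proof.
move=> FF fneA xM xz Ax0.
apply/eqP; rewrite -normr_eq0 -sqrf_eq0 eq_le sqr_ge0 andbT.
have lim0 : `|A (x k)| * (M + `|z| + 2 * `|A z|) + ('[z, A z] - '[x k, A z])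
    @[k --> F] --> (0 : R).
  rewrite -[X in _ --> X](_ : 0 * (M + `|z| + 2 * `|A z|) +
    ('[z, A z] - '[z, A z]) = 0); last by ring.
  apply: cvgD; last by apply: cvgB (xz (A z)); exact: cvg_cst.
  by apply: cvgM; [exact/norm_cvg0P|exact: cvg_cst].
apply: (cvgr_to_ge lim0); apply: filterS xM => k xkM.
have := fneA (x k) z; rewrite norm_sqB !inner_lin (innerC (A z) z) (innerC (A z)).
have := Cauchy_Schwarz (A (x k)) (x k); have := Cauchy_Schwarz (A (x k)) z.
have := Cauchy_Schwarz (A (x k)) (A z); rewrite !ler_norml.
move=> /andP[? ?] /andP[? ?] /andP[? ?] ?.
have : `|A (x k)| * `|x k| <= `|A (x k)| * M by rewrite ler_wpM2l.
have := sqr_ge0 `|A (x k)|; nra.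
Qed.

Lemma sq_dist_cvg_bounded (x : nat -> H) (c : H) :
  cvgn (fun k => `|x k - c| ^+ 2) -> exists M, \forall k \near \oo, `|x k| <= M.
Proof.
move=> /cvg_ex[l xl]; exists (`|c| + (2 + l)).
have l1 : l < 1 + l by lra.
apply: filterS (cvgr_lt _ xl _ l1) => k xk.
have := ler_normD c (x k - c); rewrite addrC subrK addrC.
(* A real t satisfies t <= 1 + t ^+ 2, here with t ^+ 2 <= 1 + l. *)
by have := sqr_ge0 (`|x k - c| - 1); nra.
Qed.

(** Ultrafilters finer than [\oo] play the role of weakly convergent
    subsequences: they all have a weak limit, which lies in [C], and it is the
    same for all of them because convergence of the squared distances to
    [z, z' : C] forces ['[x k, z - z']] to converge. *)
Lemma Opial (C : set H) (x : nat -> H) : C !=set0 ->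
  (forall z, C z -> cvgn (fun k => `|x k - z| ^+ 2)) ->
  (forall (G : set_system nat) z,
    UltraFilter G -> \oo `<=` G -> weak_cvg G x z -> C z) ->
  exists2 z, C z & weak_cvg \oo x z.
Proof.
move=> [c Cc] dist_cvg clusterC.
have [M xM] := sq_dist_cvg_bounded (dist_cvg c Cc).
have ultra_cluster G : UltraFilter G -> \oo `<=` G -> exists2 z, C z & weak_cvg G x z.
  move=> GU ooG; have [z xz] := ultra_weak_cvg GU (ooG _ xM).
  by exists z => //; apply: clusterC xz.
have cluster_uniq G G' z z' : UltraFilter G -> UltraFilter G' ->
    \oo `<=` G -> \oo `<=` G' -> C z -> C z' -> weak_cvg G x z ->
    weak_cvg G' x z' -> z = z'.
  move=> GU GU' ooG ooG' Cz Cz' xz xz'.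
  have /cvg_ex[L innerL] : cvgn (fun k => '[x k, z - z']).
    have -> : (fun k => '[x k, z - z']) = fun k => (1 / 2) *
        (`|x k - z'| ^+ 2 - `|x k - z| ^+ 2 + (`|z| ^+ 2 - `|z'| ^+ 2)).
      by apply/funext => k; rewrite !norm_sqB !inner_lin; field.
    apply: is_cvgMr; apply: is_cvgD; last exact: is_cvg_cst.
    by apply: is_cvgB; exact: dist_cvg.
  have zL : '[z, z - z'] = L.
    by apply: (cvg_unique _ (xz _)) => //; apply: cvg_trans innerL; exact: cvg_app.
  have zL' : '[z', z - z'] = L.
    by apply: (cvg_unique _ (xz' _)) => //; apply: cvg_trans innerL; exact: cvg_app.
  apply/eqP; rewrite -subr_eq0 -normr_eq0 -sqrf_eq0 -inner_normE.
  by rewrite {1}innerDl innerNl zL zL' subrr.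
have [G0 [GU0 ooG0]] : exists G, UltraFilter G /\ \oo `<=` G := ultraFilterLemma _.
have [z Cz xz] := ultra_cluster G0 GU0 ooG0; exists z => // y.
apply: cvg_ultra => G GU ooG; have [z' Cz' xz'] := ultra_cluster G GU ooG.
by rewrite (cluster_uniq G0 G z z').
Qed.

End WeakConvergence.

(** * The iteration for a firmly nonexpansive operator *)

Section Iteration.
Context {R : realType} {H : hilbertType R}.

Theorem Krasnoselskii_Mann (A : H -> H) (eps : R) (lambda_ : nat -> R)
    (x : nat -> H) :
  firmly_nonexpansive A -> [set z | A z = 0] !=set0 ->
  0 < eps -> (forall k, eps <= lambda_ k <= 2 - eps) ->
  (forall k, x k.+1 = x k - lambda_ k *: A (x k)) ->
  exists2 z, A z = 0 & weak_cvg \oo x z.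
Proof.
move=> fneA A0 eps0 lambdaP xS.
have descent z k : A z = 0 ->
    eps ^+ 2 * `|A (x k)| ^+ 2 <= `|x k - z| ^+ 2 - `|x k.+1 - z| ^+ 2.
  move=> Az; rewrite xS addrAC (norm_sqB (x k - z)) norm_sqZ innerZr.
  have := fneA (x k) z; rewrite Az subr0 (innerC (A (x k))).
  have /andP[l1 l2] := lambdaP k; have := sqr_ge0 `|A (x k)|.
  (* As eps <= l <= 2 - eps, l * (2 - l) >= eps ^+ 2. *)
  move: (lambda_ k) ('[_, _]) (`|A _| ^+ 2) l1 l2 => l p a l1 l2 a0 ap.
  have : l * a <= l * p by rewrite ler_wpM2l//; lra.
  have : 0 <= (l * (2 - l) - eps ^+ 2) * a by rewrite mulr_ge0//; nra.
  nra.
have dist_cvg z : A z = 0 -> cvgn (fun k => `|x k - z| ^+ 2).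
  move=> Az; apply: nonincreasing_is_cvgn; last first.
    by exists 0 => _ [k _ <-]; exact: sqr_ge0.
  apply/nonincreasing_seqP => k; rewrite -subr_ge0.
  by apply: le_trans (descent z k Az); rewrite mulr_ge0 ?sqr_ge0.
have Ax0 : A (x k) @[k --> \oo] --> 0.
  have [c Ac] := A0; have /cvg_ex[l xl] := dist_cvg c Ac.
  have gap0 : `|x k - c| ^+ 2 - `|x k.+1 - c| ^+ 2 @[k --> \oo] --> (0 : R).
    rewrite -(subrr l); apply: cvgB => //.
    by rewrite (cvg_shiftS (fun k => `|x k - c| ^+ 2)).
  apply/cvgr0Pnorm_lt => e e0.
  have ee : 0 < (eps * e) ^+ 2 by rewrite exprn_gt0// mulr_gt0.
  apply: filterS (cvgr_lt _ gap0 _ ee) => k gapk.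
  rewrite -ltr_sqr ?nnegrE ?(ltW e0)// -(ltr_pM2l (exprn_gt0 2 eps0)) -[ltRHS]exprMn.
  exact: le_lt_trans (descent c k Ac) gapk.
have [c Ac] := A0; have [M xM] := sq_dist_cvg_bounded (dist_cvg c Ac).
have [//|//|G z GU ooG xz|z Az xz] := @Opial R H [set z | A z = 0] x; last by exists z.
rewrite /=; apply: (firmly_nonexpansive_demiclosed _ fneA (ooG _ xM) xz).
by apply: cvg_trans Ax0; exact: cvg_app.
Qed.

End Iteration.

(** * Composition of relaxed firmly nonexpansive operators *)

Lemma subr_interchange (V : zmodType) (a b c d : V) :
  (a - b) - (c - d) = (a - c) - (b - d).
Proof. by rewrite !opprD !opprK addrACA. Qed.

Section Composition.
Context {R : realType} {H : hilbertType R}.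

Lemma scaled_firmly_nonexpansiveE (c : R) (d u : H) : 0 < c ->
  (`|c^-1 *: d| ^+ 2 <= '[c^-1 *: d, u]) = (`|d| ^+ 2 <= c * '[d, u]).
Proof.
move=> c0; have c1 := lt0r_neq0 c0.
rewrite norm_sqZ innerZl -(ler_pM2l (exprn_gt0 2 c0)); congr (_ <= _); by field.
Qed.

Lemma firmly_nonexpansive_compl (S : H -> H) :
  firmly_nonexpansive S -> firmly_nonexpansive (fun x => x - S x).
Proof.
move=> fneS x y; have := fneS x y; rewrite subr_interchange.
move: (S x - S y) (x - y) => s d.
by rewrite norm_sqB innerDl innerNl inner_normE (innerC d); lra.
Qed.

(** Measuring the relaxed operator by its displacement turns relaxed firm
    nonexpansiveness into an inequality on [x - T x] that composes well and in
    which the existential over [S] has disappeared: by complementation, [S] is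
    firmly nonexpansive iff [Id - S], which is [lambda^-1 *: (Id - T)], is. *)
Lemma relaxed_firmly_nonexpansiveP (lambda : R) (T : H -> H) : 0 < lambda ->
  relaxed_firmly_nonexpansive lambda T <->
  firmly_nonexpansive (fun x => lambda^-1 *: (x - T x)).
Proof.
move=> lambda0; have lambdaN0 := lt0r_neq0 lambda0.
split=> [[S fneS TE] x y|fneG].
  have := firmly_nonexpansive_compl fneS x y.
  suff E z : lambda^-1 *: (z - T z) = z - S z by rewrite !E.
  by rewrite TE opprD addrA subrr sub0r -scalerN opprB scalerA mulVf// scale1r.
exists (fun x => x - lambda^-1 *: (x - T x)); first exact: firmly_nonexpansive_compl.
move=> x; rewrite [_ - x]addrAC subrr sub0r scalerN scalerA divff// scale1r.
by rewrite opprB addrC subrK.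
Qed.

(** By the inequality of means, [(lambda + mu) ^+ 2 >= 4 * (lambda * mu)], and
    [4 * (lambda * mu)] exceeds [(lambda * mu) ^+ 2] as [lambda * mu < 4]. *)
Lemma mul_lt_add (lambda mu : R) : 0 < lambda -> 0 < mu -> lambda * mu < 4 ->
  lambda * mu < lambda + mu.
Proof.
move=> l0 m0 lm4; have p0 := mulr_gt0 l0 m0; have sq := sqr_ge0 (lambda - mu).
rewrite -ltr_sqr ?nnegrE ?ltW ?addr_gt0//.
apply: (@lt_le_trans _ _ (4 * (lambda * mu))); last by nra.
by rewrite expr2 ltr_pM2r.
Qed.

(** Put [D := 4 - lambda * mu] and [N := 4 * (lambda + mu - lambda * mu)]. The
    slack in the conclusion, multiplied by [lambda * mu * D > 0], is [N * mu]
    times the slack in the bound on [a], plus [N * lambda] times the slack in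
    the bound on [b], plus the square of the norm of
    [mu * (2 - lambda) * a - lambda * (2 - mu) * b]. *)
Lemma cocoercive_sum (lambda mu : R) (a b u : H) :
  0 < lambda -> 0 < mu -> lambda * mu < 4 ->
  `|a| ^+ 2 <= lambda * '[a, u] -> `|b| ^+ 2 <= mu * '[b, u - a] ->
  `|a + b| ^+ 2 <=
    4 * (lambda + mu - lambda * mu) / (4 - lambda * mu) * '[a + b, u].
Proof.
move=> l0 m0 lm4; rewrite innerDr innerNr (innerC b a) innerDl => ha hb.
have D0 : 0 < 4 - lambda * mu by rewrite subr_gt0.
have N0 : 0 < 4 * (lambda + mu - lambda * mu).
  by rewrite mulr_gt0// subr_gt0 mul_lt_add.
have : 0 <= `|(mu * (2 - lambda)) *: a - (lambda * (2 - mu)) *: b| ^+ 2.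
  exact: sqr_ge0.
rewrite norm_sqB norm_sqD !norm_sqZ innerZl innerZr => sq.
rewrite mulrAC ler_pdivlMr// mulrC -subr_ge0 -(pmulr_rge0 _ (mulr_gt0 l0 m0)).
move: ('[a, u]) ('[b, u]) ('[a, b]) (`|a| ^+ 2) (`|b| ^+ 2) ha hb sq.
move=> r q p A B; rewrite -subr_ge0 -(subr_ge0 B) => ha hb sq.
have hA := mulr_ge0 (ltW N0) (mulr_ge0 (ltW m0) ha).
have hB := mulr_ge0 (ltW N0) (mulr_ge0 (ltW l0) hb).
apply: le_trans (addr_ge0 (addr_ge0 hA hB) sq) _.
by rewrite le_eqVlt; apply/orP; left; apply/eqP; ring.
Qed.

Theorem relaxed_firmly_nonexpansive_comp (lambda mu : R) (T U : H -> H) :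
  0 < lambda -> 0 < mu -> lambda * mu < 4 ->
  relaxed_firmly_nonexpansive lambda T -> relaxed_firmly_nonexpansive mu U ->
  relaxed_firmly_nonexpansive
    (4 * (lambda + mu - lambda * mu) / (4 - lambda * mu)) (U \o T).
Proof.
move=> l0 m0 lm4 /(relaxed_firmly_nonexpansiveP _ l0) fneT.
move=> /(relaxed_firmly_nonexpansiveP _ m0) fneU.
have nu0 : 0 < 4 * (lambda + mu - lambda * mu) / (4 - lambda * mu).
  by rewrite divr_gt0 ?mulr_gt0 ?subr_gt0// mul_lt_add.
apply/relaxed_firmly_nonexpansiveP => // x y.
have := fneU (T x) (T y); have := fneT x y.
rewrite -!scalerBr !scaled_firmly_nonexpansiveE //=.
set a := x - T x - _ => ha.
have -> : T x - T y = (x - y) - a by rewrite /a subr_interchange !subKr.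
have -> : x - U (T x) - (y - U (T y)) =
    a + (T x - U (T x) - (T y - U (T y))) by rewrite /a addrACA -opprD !subrKA.
exact: cocoercive_sum.
Qed.

End Composition.

(** * The relaxed iteration of the composition *)

Theorem corollary4p2 (R : realType) (H : hilbertType R)
    (H_neq0 : exists z : H, z != 0)
    (lambda mu : R) (lambda_gt0 : 0 < lambda) (mu_gt0 : 0 < mu)
    (lambda_mu_lt4 : lambda * mu < 4)
    (T U : H -> H)
    (T_RFNE : relaxed_firmly_nonexpansive lambda T)
    (U_RFNE : relaxed_firmly_nonexpansive mu U)
    (Fix_neq0 : fixpoints (U \o T) !=set0) :
  let nu := 4 * (lambda + mu - lambda * mu) / (4 - lambda * mu) in
  forall (x0 : H) (eps : R) (lambda_ : nat -> R) (x : nat -> H),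
    0 < eps < 1 ->
    (forall k : nat, eps <= lambda_ k <= 2 - eps) ->
    x 0%N = x0 ->
    (forall k : nat,
      x k.+1 = x k + (lambda_ k / nu) *: ((U \o T) (x k) - x k)) ->
  exists2 z : H, fixpoints (U \o T) z & weakly_converges x z.
Proof.
move=> nu x0 eps lambda_ x /andP[eps0 _] lambdaP _ xS.
have nu0 : 0 < nu.
  by rewrite divr_gt0 ?mulr_gt0 ?subr_gt0// mul_lt_add.
have fneA : firmly_nonexpansive (fun z => nu^-1 *: (z - (U \o T) z)).
  exact/relaxed_firmly_nonexpansiveP/relaxed_firmly_nonexpansive_comp.
have zeroA z : nu^-1 *: (z - (U \o T) z) = 0 <-> fixpoints (U \o T) z.
  split=> [/eqP|Uz]; last by rewrite Uz subrr scaler0.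
  by rewrite scaler_eq0 invr_eq0 (gt_eqF nu0) /= subr_eq0 => /eqP.
have [||z Az xz] := Krasnoselskii_Mann fneA _ eps0 lambdaP (x := x).
- by have [z /zeroA Az] := Fix_neq0; exists z.
- by move=> k; rewrite xS scalerA -scalerN opprB.
by exists z => //; apply/zeroA.
Qed.
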